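(* Let $s\in\{1,-1\}$ and consider on the half-line graph $\mathbb{N}$ the canonical quantum Riemannian geometry with metric parameters $h_i\in\mathbb{R}\setminus\{0\}$, $i\ge1$. There is a unique choice $\{h_i\}$ up to overall normalisation such that the Ricci scalar vanishes, $S=0$. It is given, for any initial value $h_1$, by $$s=1:\quad h_i=2h_1\frac{(2\lfloor i/2\rfloor+1)^2}{i+1}=2h_1\begin{cases} i+1 & i\text{ even}\\ \frac{i^2}{i+1} & i\text{ odd,}\end{cases}$$ $$s=-1:\quad h_i=2h_1\frac{\lceil i/2\rceil^2}{i+1}=\frac{h_1}{2}\begin{cases}\frac{i^2}{i+1} & i\text{ even}\\ i+1& i\text{ odd.}\end{cases}$$
   Context: **Calculus.** $\mathbb{N}=\{1,2,3,\dots\}$ is the graph with an edge $i-(i+1)$ for each $i\ge1$. $A=\mathbb{C}(\mathbb{N})$ is the algebra of complex functions on the vertices, $\delta_i$ the Kronecker delta function at $i$. $\Omega^1$ is the space of all (possibly infinite) linear combinations of the arrows $a_i=\omega_{i\to i+1}$, $a_i'=\omega_{i+1\to i}$, $i\ge1$. It is an $A$-bimodule via $f a_i=f(i)a_i$, $a_i f=f(i+1)a_i$, $f a_i'=f(i+1)a_i'$, $a_i'f=f(i)a_i'$, with $\mathrm{d}f=\sum_i (f(i+1)-f(i))(a_i-a_i')$. $\Omega^1\otimes_A\Omega^1$ consists of (possibly infinite) linear combinations of the 2-step paths $a_i\otimes a_{i+1}$, $a_{i+1}'\otimes a_i'$, $a_i\otimes a_i'$, $a_i'\otimes a_i$ ($\otimes$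 means $\otimes_A$). $\Omega^2$ is the quotient of $\Omega^1\otimes_A\Omega^1$ (quotient map $\wedge$) by $a_i\wedge a_{i+1}=0$, $a_{i+1}'\wedge a_i'=0$, $a_1\wedge a_1'=0$, $a_{i+1}\wedge a_{i+1}'+a_i'\wedge a_i=0$ for $i\ge1$. With $\theta=\sum_i(a_i+a_i')$, $\mathrm{d}:\Omega^1\to\Omega^2$ is $\mathrm{d}\omega=\theta\wedge\omega+\omega\wedge\theta$. **Canonical quantum Riemannian geometry.** The metric is $g=\sum_{i\ge1}h_i(\phi_i\,a_i\otimes a_i'+a_i'\otimes a_i)$ with $\phi_i=\frac{i+1}{i}$. The inverse metric is the bimodule map $(\ ,\ ):\Omega^1\otimes_A\Omega^1\to A$ with $(a_i,a_i')=\delta_i/h_i$, $(a_i',a_i)=\delta_{i+1}/(h_i\phi_i)$ and zero on the other 2-step paths. The connection is $\nabla:\Omega^1\to\Omega^1\otimes_A\Omega^1$, $\nabla\omega=\theta\otimes\omega-\sigma(\omega\otimes\theta)$, where $\sigma$ is the bimodule map with $\sigma(a_i\otimes a_{i+1})=\sigma_i\,a_i\otimes a_{i+1}$; $\sigma(a_i'\otimes a_{i-1}')=\sigma_i'\,a_i'\otimes a_{i-1}'$ ($i\ge2$); $\sigma(a_1\otimes a_1')=\tau_1\,a_1\otimes a_1'$; $\sigma(a_i\otimes a_i')=\tau_i\,a_i\otimes a_i'+(1+\tau_i)\,a_{i-1}'\otimes a_{i-1}$ ($i\ge2$); $\sigma(a_i'\otimes a_i)=\tau_i'\,a_i'\otimes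 a_i+(1+\tau_i')\,a_{i+1}\otimes a_{i+1}'$ ($i\ge1$), and $\tau_i=\frac{s(-1)^{i-1}}{i}$, $\tau_i'=-\tau_{i+1}$, $\sigma_i=\frac{h_{i+1}}{h_i}(1+\tau_{i+1})$, $\sigma_i'=\frac{h_{i-1}}{h_i}\frac1{1+\tau_i}$. **Curvature.** $R_\nabla=(\mathrm{d}\otimes\mathrm{id}-\mathrm{id}\wedge\nabla)\nabla:\Omega^1\to\Omega^2\otimes_A\Omega^1$. The lifting bimodule map $\iota:\Omega^2\to\Omega^1\otimes_A\Omega^1$ is $\iota(a_i\wedge a_i')=-\iota(a_{i-1}'\wedge a_{i-1})=\frac12(a_i\otimes a_i'-a_{i-1}'\otimes a_{i-1})$, $i\ge2$. Then $\mathrm{Ricci}=((\ ,\ )\otimes\mathrm{id}\otimes\mathrm{id})(\mathrm{id}\otimes\iota\otimes\mathrm{id})(\mathrm{id}\otimes R_\nabla)g\in\Omega^1\otimes_A\Omega^1$ and the Ricci scalar is $S=(\ ,\ )(\mathrm{Ricci})\in A$. *)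

(* Defs.v *)
From HB Require Import structures.
From mathcomp Require Import all_boot all_order all_algebra.
From mathcomp Require Import boolp classical_sets functions cardinality fsbigop.
From mathcomp Require Import reals complex.

Set Implicit Arguments.
Unset Strict Implicit.
Unset Printing Implicit Defensive.

Import Order.TTheory GRing.Theory Num.Theory.
Local Open Scope ring_scope.

(* Index conventions.  The vertices of the half-line graph are 1, 2, 3, ...;
   [k : nat] stands for the vertex k+1.  Real parameters (h, phi, tau, ...)
   keep the numbering from 1: they are functions of i : nat that are only
   ever evaluated at i >= 1.

   All bimodules over A = C(vertices) used here consist of the possibly
   infinite linear combinations of a set of basis elements, each of which has
   a source and a target vertex: f . b = f(src b) b and b . f = f(tgt b) b. *)

Record basis := Basis {
  cell :> choiceType;
  src : cell -> nat;
  tgt : cell -> nat }.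

(* The tensor product over A has as basis the composable pairs. *)
Definition composable (B D : basis) : pred (B * D) :=
  fun p => tgt p.1 == src p.2.

Definition tensor (B D : basis) : basis :=
  @Basis {p : B * D | composable p}
    (fun p => src (val p).1) (fun p => tgt (val p).2).

Inductive arrow := up of nat | dn of nat.

Definition arrow_code (x : arrow) : nat + nat :=
  match x with up k => inl k | dn k => inr k end.
Definition arrow_decode (x : nat + nat) : arrow :=
  match x with inl k => up k | inr k => dn k end.
Lemma arrow_codeK : cancel arrow_code arrow_decode. Proof. by case. Qed.
HB.instance Definition _ := Choice.copy arrow (can_type arrow_codeK).

Definition arrow_src (x : arrow) : nat :=
  match x with up k => k | dn k => k.+1 end.
Definition arrow_tgt (x : arrow) : nat :=
  match x with up k => k.+1 | dn k => k end.

(* A itself. *)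
Definition Om0 : basis := @Basis nat id id.
(* up k is a_{k+1} : k+1 -> k+2, and dn k is a'_{k+1} : k+2 -> k+1. *)
Definition Om1 : basis := @Basis arrow arrow_src arrow_tgt.
(* The cell k is the class of the loop a_{k+2} a'_{k+2} at the vertex k+2.
   That this is the stated quotient of Om1 (x) Om1 is proved below, in
   wedge_surj and wedge_ker. *)
Definition Om2 : basis := @Basis nat S S.
Definition Om11 : basis := tensor Om1 Om1.

Section Geometry.
Variable R : realType.
Local Notation C := (R[i]).

Definition form (B : basis) : Type := B -> C^o.

Definition lact (B : basis) (f : form Om0) (x : form B) : form B :=
  fun b => f (src b) * x b.
Definition ract (B : basis) (x : form B) (f : form Om0) : form B :=
  fun b => x b * f (tgt b).

Definition e (B : basis) (b : B) : form B := fun b' => (b' == b)%:R.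

Definition tens (B D : basis) (x : form B) (y : form D) : form (tensor B D) :=
  fun p => x (val p).1 * y (val p).2.
Local Notation "x ⊗ y" := (tens x y) (at level 40, left associativity).

Lemma tens_balanced (B D : basis) (x : form B) (f : form Om0) (y : form D) :
  ract x f ⊗ y = x ⊗ lact f y.
Proof.
apply/funext => -[[b c] /= bc]; rewrite /tens /ract /lact /=.
by move/eqP: bc => /= ->; rewrite mulrA.
Qed.

(* The map with b |-> phi b on the basis, applied to infinite combinations
   term by term: each coefficient of the result is a finitely supported sum in
   all the uses below. *)
Definition ext (B D : basis) (phi : B -> form D) (x : form B) : form D :=
  fun q => \sum_(b \in [set: B]) (x b * phi b q).

Lemma ext_seq (B D : basis) (phi : B -> form D) (x : form B) q (l : seq B) :
  uniq l -> (forall b, b \notin l -> phi b q = 0) ->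
  ext phi x q = \sum_(b <- l) x b * phi b q.
Proof.
move=> ul phi0; rewrite /ext (fsbigE (l)) //.
  by apply: eq_bigl => b; rewrite in_setT.
by move=> b _ bl; rewrite phi0 ?mulr0.
Qed.

Lemma ext_e (B D : basis) (phi : B -> form D) (b : B) : ext phi (e b) = phi b.
Proof.
apply/funext => q; rewrite /ext (fsbigE ([:: b])) //.
  by rewrite big_cons big_nil in_setT /= addr0 /e eqxx mul1r.
by move=> b' _; rewrite inE /e => /negbTE ->; rewrite mul0r.
Qed.

(* phi (x) id and id (x) phi, evaluated on the basis b (x) d. *)
Definition lmap (B B' D : basis) (phi : form B -> form B') :
    form (tensor B D) -> form (tensor B' D) :=
  ext (fun p : tensor B D => phi (e (val p).1) ⊗ e (val p).2).
Definition rmap (B D D' : basis) (phi : form D -> form D') :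
    form (tensor B D) -> form (tensor B D') :=
  ext (fun p : tensor B D => e (val p).1 ⊗ phi (e (val p).2)).

(* The canonical isomorphisms B(x)(D(x)E) = (B(x)D)(x)E and A(x)B = B. *)
Definition assocl (B D E : basis) :
    form (tensor B (tensor D E)) -> form (tensor (tensor B D) E) :=
  ext (fun p : tensor B (tensor D E) => let: (b, q) := val p in let: (c, c') := val q in
    (e b ⊗ e c) ⊗ e c').
Definition assocr (B D E : basis) :
    form (tensor (tensor B D) E) -> form (tensor B (tensor D E)) :=
  ext (fun p : tensor (tensor B D) E => let: (q, c') := val p in let: (b, c) := val q in
    e b ⊗ (e c ⊗ e c')).
Definition unitl (B : basis) : form (tensor Om0 B) -> form B :=
  ext (fun p : tensor Om0 B => lact (e (val p).1) (e (val p).2)).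

(* In the definitions by cases on a composable pair of arrows, composability
   forces the index that is not named in the pattern. *)

Definition wedge : form Om11 -> form Om2 :=
  ext (fun p : Om11 => match val p with
  | (up k.+1, dn _) => e (k : Om2)
  | (dn k, up _) => - e (k : Om2)
  | _ => 0
  end).

Definition up_dn (k : nat) : Om11 :=
  exist (@composable Om1 Om1) (up k, dn k) (eqxx _).
Definition dn_up (k : nat) : Om11 :=
  exist (@composable Om1 Om1) (dn k, up k) (eqxx _).

Lemma wedgeE (x : form Om11) (k : Om2) :
  wedge x k = x (up_dn k.+1) - x (dn_up k).
Proof.
rewrite /wedge (@ext_seq _ _ _ _ _ [:: up_dn k.+1; dn_up k]) //.
  rewrite !big_cons big_nil /= addr0 /GRing.opp /= /e eqxx.
  by rewrite mulr1 mulrN1.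
move=> q; rewrite !in_cons orbF negb_or => /andP[].
case: q => [[[[|i]|i] [j|j]] p] H1 H2 //=.
- rewrite /e; case: eqP => // ki; case/negP: H1; apply/eqP/val_inj.
  by move: (p) => /eqP /= [<-]; rewrite ki.
- rewrite /GRing.opp /= /e; case: eqP => [ki|]; last by rewrite oppr0.
  case/negP: H2; apply/eqP/val_inj.
  by move: (p) => /eqP /= <-; rewrite ki.
Qed.

Lemma wedge_surj (y : form Om2) : exists x, wedge x = y.
Proof.
exists (fun p => match val p with (up k.+1, dn _) => y k | _ => 0 end).
by apply/funext => k; rewrite wedgeE /= subr0.
Qed.

(* The kernel of wedge consists of the possibly infinite combinations of
   a_i (x) a_{i+1}, a'_{i+1} (x) a'_i, a_1 (x) a'_1 and
   a_{i+1} (x) a'_{i+1} + a'_i (x) a_i, with coefficients al, be, ga, ep. *)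
Lemma wedge_ker (x : form Om11) :
  wedge x = 0 <->
  exists (al be ep : nat -> C) (ga : C), forall p, x p = match val p with
    | (up k, up _) => al k
    | (dn _, dn k) => be k
    | (up 0, dn _) => ga
    | (up k.+1, dn _) => ep k
    | (dn k, up _) => ep k
    end.
Proof.
split=> [x0|[al [be [ep [ga xE]]]]]; last first.
  by apply/funext => k; rewrite wedgeE !xE /= subrr.
have uu k : @composable Om1 Om1 (up k, up k.+1) by apply/eqP.
have dd k : @composable Om1 Om1 (dn k.+1, dn k) by apply/eqP.
exists (fun k => x (exist (@composable Om1 Om1) (up k, up k.+1) (uu k))).
exists (fun k => x (exist (@composable Om1 Om1) (dn k.+1, dn k) (dd k))).
exists (fun k => x (dn_up k)), (x (up_dn 0)).
have xP u v pu pv : u = v ->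
    x (exist (@composable Om1 Om1) u pu) = x (exist _ v pv).
  by move=> uv; congr x; apply: val_inj.
move=> [[[[|k]|k] [j|j]] /= p]; move/eqP: (p) => /= pE;
  try by apply: xP; (rewrite ?pE // -pE || case: pE => <-).
have := congr1 (@^~ k) x0; rewrite wedgeE => /eqP; rewrite subr_eq0 => /eqP <-.
by apply: xP; case: pE => <-.
Qed.

Local Notation "x ∧ y" := (wedge (x ⊗ y)) (at level 40, left associativity).

Definition theta : form Om1 := fun=> 1.

Definition d1 (x : form Om1) : form Om2 := theta ∧ x + x ∧ theta.

Definition iota : form Om2 -> form Om11 :=
  ext (fun k : Om2 => (2^-1 : C) *:
    (e (up k.+1 : Om1) ⊗ e (dn k.+1 : Om1) - e (dn k : Om1) ⊗ e (up k : Om1))).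

Section Metric.
Variables (s : R) (h : nat -> R).

Definition phi (i : nat) : R := i.+1%:R / i%:R.
Definition tau (i : nat) : R := s * (-1) ^+ i.-1 / i%:R.
Definition tau' (i : nat) : R := - tau i.+1.
Definition sig (i : nat) : R := h i.+1 / h i * (1 + tau i.+1).
Definition sig' (i : nat) : R := h i.-1 / h i * (1 + tau i)^-1.

Local Notation a k := (e (up k : Om1)).
Local Notation a' k := (e (dn k : Om1)).

Definition metric : form Om11 := fun p => match val p with
  | (up k, dn _) => (h k.+1 * phi k.+1)%:C
  | (dn k, up _) => (h k.+1)%:C
  | _ => 0
  end%C.

Definition ip : form Om11 -> form Om0 :=
  ext (fun p : Om11 => match val p with
  | (up k, dn _) => ((h k.+1)^-1)%:C *: e (k : Om0)
  | (dn k, up _) => ((h k.+1 * phi k.+1)^-1)%:C *: e (k.+1 : Om0)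
  | _ => 0
  end%C).

Definition sigma : form Om11 -> form Om11 :=
  ext (fun p : Om11 => match val p with
  | (up k, up _) => (sig k.+1)%:C *: (a k ⊗ a k.+1)
  | (dn k.+1, dn _) => (sig' k.+2)%:C *: (a' k.+1 ⊗ a' k)
  | (up 0, dn _) => (tau 1)%:C *: (a 0 ⊗ a' 0)
  | (up k.+1, dn _) => (tau k.+2)%:C *: (a k.+1 ⊗ a' k.+1)
                     + (1 + tau k.+2)%:C *: (a' k ⊗ a k)
  | (dn k, up _) => (tau' k.+1)%:C *: (a' k ⊗ a k)
                  + (1 + tau' k.+1)%:C *: (a k.+1 ⊗ a' k.+1)
  | (dn 0, dn _) => 0 (* not composable *)
  end%C).

Definition nabla (x : form Om1) : form Om11 := theta ⊗ x - sigma (x ⊗ theta).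

(* The operator d (x) id - id /\ nabla is well defined on Om1 (x) Om1 although
   neither of its two terms is; it is evaluated on the basis b (x) c. *)
Definition Rnabla (x : form Om1) : form (tensor Om2 Om1) :=
  ext (fun p : Om11 => let: (b, c) := val p in
    d1 (e b) ⊗ e c - lmap wedge (assocl (e b ⊗ nabla (e c)))) (nabla x).

Definition Ricci : form Om11 :=
  unitl (lmap ip (assocl (rmap (@assocr Om1 Om1 Om1)
    (rmap (lmap iota) (rmap Rnabla metric))))).

Definition ricci_scalar : form Om0 := ip Ricci.

Definition ricci_scalar_flat : Prop :=
  (forall i : nat, (0 < i)%N -> h i != 0) /\ ricci_scalar = 0.
End Metric.

Definition flat_plus (h1 : R) (i : nat) : R :=
  2 * h1 * (2 * i./2 + 1)%:R ^+ 2 / i.+1%:R.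
(* [uphalf i] is the ceiling of i/2. *)
Definition flat_minus (h1 : R) (i : nat) : R :=
  2 * h1 * (uphalf i)%:R ^+ 2 / i.+1%:R.
Definition flat_seq (s h1 : R) : nat -> R :=
  if s == 1 then flat_plus h1 else flat_minus h1.
End Geometry.

(* Main.v *)
Require Import Defs.
From mathcomp Require Import all_boot all_order all_algebra.
From mathcomp Require Import boolp classical_sets functions cardinality fsbigop.
From mathcomp Require Import reals complex.
From mathcomp Require Import ring lra.
Import Order.TTheory GRing.Theory Num.Theory.
Local Open Scope ring_scope.

(* Write h_j, tau_j as in the paper, numbered from 1.  Coefficient by
   coefficient, S_i is a combination of the coefficient P_i of a'_i in the
   curvature of a'_i and the coefficient Q_{i-1} of a_{i-1} in the curvature of
   a_{i-1} (absent for i < 3).  Put r_j = j/(j-1) (1 - tau_j)/(1 + tau_j).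
   Since tau_j tau_{j+1} = -1/(j(j+1)) and tau_j^2 = 1/j^2, the relations
   h_j = r_j h_{j-1} for j = i and j = i-1 imply Q_{i-1} = 0 and
   P_i = i/(i+1) (1 - r_{i+1} h_i / h_{i+1}).  By induction on i, S = 0 is
   therefore equivalent to h_j = r_j h_{j-1} for all j > 1, a recursion that the
   closed forms solve. *)

(** * Coefficients of linear extensions and of maps on tensor products *)

Section Coefficients.
Context {R : realType}.
Local Notation form B := (Defs.form R B).
Local Notation e := (Defs.e R).

Lemma ext1 {B D : basis} (psi : B -> form D) (x : form B) q (b0 : B) :
  (forall b, b != b0 -> psi b q = 0) -> ext psi x q = x b0 * psi b0 q.
Proof.
move=> psi0; rewrite (@ext_seq _ _ _ _ _ _ [:: b0]) //.
  by rewrite big_cons big_nil addr0.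
by move=> b; rewrite mem_seq1; apply: psi0.
Qed.

(** Companion of [ext_seq]: there the sum is finite because few basis elements reach [q], here
    because [x] has finite support. *)
Lemma ext_support {B D : basis} (psi : B -> form D) (x : form B) q (l : seq B) :
  uniq l -> (forall b, b \notin l -> x b = 0) ->
  ext psi x q = \sum_(b <- l) x b * psi b q.
Proof.
move=> ul x0; rewrite /ext (fsbigE l) //.
  by apply: eq_bigl => b; rewrite in_setT.
by move=> b _ bl; rewrite x0 ?mul0r.
Qed.

(** A slice is extended by 0 to the basis elements that do not compose with [d], so that it is again
    a form on all of [B], to which [ext] applies. *)
Definition slicer {B D : basis} (x : form (tensor B D)) (d : D) : form B :=
  fun b => oapp x 0 (insub (b, d) : option (tensor B D)).
Definition slicel {B D : basis} (x : form (tensor B D)) (b : B) : form D :=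
  fun d => oapp x 0 (insub (b, d) : option (tensor B D)).

Lemma slicerE {B D : basis} (x : form (tensor B D)) b d
  (bd : @composable B D (b, d)) : slicer x d b = x (exist _ (b, d) bd).
Proof. by rewrite /slicer insubT. Qed.

Lemma slicelE {B D : basis} (x : form (tensor B D)) b d
  (bd : @composable B D (b, d)) : slicel x b d = x (exist _ (b, d) bd).
Proof. by rewrite /slicel insubT. Qed.

(** The factor [e d] kills every pair whose second entry is not [d]. The remaining pairs are in
    bijection with the [b] composable with [d], which turns the sum over [tensor B D] into a sum
    over [B]. *)
Lemma lmap_extE {B B' D : basis} (psi : form B -> form B')
    (x : form (tensor B D)) q :
  lmap psi x q = ext (psi \o e (B:=B)) (slicer x (val q).2) (val q).1.
Proof.
rewrite /lmap /ext; set d := (val q).2; set b' := (val q).1.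
rewrite -(@fsbig_widen _ _ _ _ [set p : tensor B D | (val p).2 = d]) //; last first.
  move=> p [_ /= /eqP pd]; rewrite /tens /Defs.e -/d eq_sym (negbTE pd).
  by rewrite !mulr0.
rewrite -[RHS](@fsbig_widen _ _ _ _ [set b : B | @composable B D (b, d)]) //; last first.
  by move=> b [_ /= /negP bd]; rewrite /slicer insubN // mul0r.
rewrite [RHS](@reindex_fsbig _ _ _ _ _ (fun p : tensor B D => (val p).1)
  [set p : tensor B D | (val p).2 = d]).
  apply: eq_fsbigr => -[[b c] /= bc]; rewrite inE /= => cd; subst c.
  by rewrite slicerE /tens /Defs.e /= -/d eqxx mulr1.
split.
- by move=> [[b c] bc] /= <-.
- move=> [[b c] bc] [[b1 c1] bc1]; rewrite !inE /= => cd cd1 bb.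
  by apply: val_inj; rewrite /= cd cd1 bb.
- by move=> b bd; exists (exist _ (b, d) bd).
Qed.

Lemma rmap_extE {B D D' : basis} (psi : form D -> form D')
    (x : form (tensor B D)) q :
  rmap psi x q = ext (psi \o e (B:=D)) (slicel x (val q).1) (val q).2.
Proof.
rewrite /rmap /ext; set b := (val q).1; set d' := (val q).2.
rewrite -(@fsbig_widen _ _ _ _ [set p : tensor B D | (val p).1 = b]) //; last first.
  move=> p [_ /= /eqP pb]; rewrite /tens /Defs.e -/b eq_sym (negbTE pb).
  by rewrite mul0r mulr0.
rewrite -[RHS](@fsbig_widen _ _ _ _ [set d : D | @composable B D (b, d)]) //; last first.
  by move=> d [_ /= /negP bd]; rewrite /slicel insubN // mul0r.
rewrite [RHS](@reindex_fsbig _ _ _ _ _ (fun p : tensor B D => (val p).2)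
  [set p : tensor B D | (val p).1 = b]).
  apply: eq_fsbigr => -[[c d] /= cd]; rewrite inE /= => cb; subst c.
  by rewrite slicelE /tens /Defs.e /= -/b eqxx mul1r.
split.
- by move=> [[c d] cd] /= <-.
- move=> [[c d] cd] [[c1 d1] cd1]; rewrite !inE /= => cb cb1 dd.
  by apply: val_inj; rewrite /= cb cb1 dd.
- by move=> d bd; exists (exist _ (b, d) bd).
Qed.

(** An [ext] operator is recovered from its values on basis elements, so [lmap] acts on each slice
    as that operator itself. *)
Lemma lmapE {B B' D : basis} (psi : B -> form B') (x : form (tensor B D)) q :
  lmap (ext psi) x q = ext psi (slicer x (val q).2) (val q).1.
Proof.
rewrite lmap_extE.
have -> : ext psi \o e (B:=B) = psi by apply/funext => b; exact: ext_e.
by [].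
Qed.

Lemma rmapE {B D D' : basis} (psi : D -> form D') (x : form (tensor B D)) q :
  rmap (ext psi) x q = ext psi (slicel x (val q).1) (val q).2.
Proof.
rewrite rmap_extE.
have -> : ext psi \o e (B:=D) = psi by apply/funext => b; exact: ext_e.
by [].
Qed.

(** Takes composability as an equation of vertices, which [erefl] proves for concrete arrows. *)
Definition cpair {B D : basis} {b : B} {d : D} (bd : tgt b = src d) :
    tensor B D := exist _ (b, d) (introT eqP bd).

Lemma slicer_cpair {B D : basis} (x : form (tensor B D)) b d bd :
  slicer x d b = x (@cpair B D b d bd).
Proof. exact: slicerE. Qed.

Lemma slicel_cpair {B D : basis} (x : form (tensor B D)) b d bd :
  slicel x b d = x (@cpair B D b d bd).
Proof. exact: slicelE. Qed.

Lemma assoclE {B D E : basis} (x : form (tensor B (tensor D E)))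
    (b : B) (c : D) (c' : E) (bc : tgt b = src c) (cc' : tgt c = src c') :
  assocl x (@cpair (tensor B D) E (cpair bc) c' cc') =
  x (@cpair B (tensor D E) b (cpair cc') bc).
Proof.
rewrite /assocl (@ext1 _ _ _ _ _ (@cpair B (tensor D E) b (cpair cc') bc)) /=.
  by rewrite /tens /Defs.e /= !eqxx !mulr1.
move=> [[b1 [[c1 c1'] /= cc1]] /= bcc1] ne; rewrite /tens /Defs.e /=.
case: eqP => [?|]; last by rewrite !mul0r.
case: eqP => [?|]; last by rewrite mulr0 mul0r.
case: eqP => [?|]; last by rewrite mulr0.
subst b1 c1 c1'; case/negP: ne; apply/eqP/val_inj => /=.
by congr (_, _); apply: val_inj.
Qed.

Lemma assocrE {B D E : basis} (x : form (tensor (tensor B D) E))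
    (b : B) (c : D) (c' : E) (bc : tgt b = src c) (cc' : tgt c = src c') :
  assocr x (@cpair B (tensor D E) b (cpair cc') bc) =
  x (@cpair (tensor B D) E (cpair bc) c' cc').
Proof.
rewrite /assocr (@ext1 _ _ _ _ _ (@cpair (tensor B D) E (cpair bc) c' cc')) /=.
  by rewrite /tens /Defs.e /= !eqxx !mulr1.
move=> [[[[b1 c1] /= bc1] c1'] /= bcc1] ne; rewrite /tens /Defs.e /=.
case: eqP => [?|]; last by rewrite mul0r.
case: eqP => [?|]; last by rewrite mul0r mulr0.
case: eqP => [?|]; last by rewrite !mulr0.
subst b1 c1 c1'; case/negP: ne; apply/eqP/val_inj => /=.
by congr (_, _); apply: val_inj.
Qed.

Lemma unitlE {B : basis} (x : form (tensor Om0 B)) b :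
  unitl x b = x (@cpair Om0 B (src b) b erefl).
Proof.
rewrite /unitl (@ext1 _ _ _ _ _ (@cpair Om0 B (src b) b erefl)) /=.
  by rewrite /lact /Defs.e /= !eqxx !mulr1.
move=> [[v b1] /= vb] ne; rewrite /lact /Defs.e /=.
case: eqP => [?|]; last by rewrite mul0r.
case: eqP => [?|]; last by rewrite mulr0.
by subst v b1; case/negP: ne; apply/eqP/val_inj.
Qed.

End Coefficients.

(** * Inverse metric, lifting map, connection and curvature in coefficients *)

Section Operators.
Context {R : realType}.
Local Notation C := (R[i]).
Local Notation form B := (Defs.form R B).
Local Notation e := (Defs.e R).

Lemma up_eq i j : (up i == up j) = (i == j).
Proof. by apply/eqP/eqP => [[]|->]. Qed.
Lemma dn_eq i j : (dn i == dn j) = (i == j).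
Proof. by apply/eqP/eqP => [[]|->]. Qed.
Lemma up_dnF i j : (up i == dn j) = false.
Proof. by apply/eqP. Qed.
Lemma dn_upF i j : (dn i == up j) = false.
Proof. by apply/eqP. Qed.
Definition arrow_eqE := (up_eq, dn_eq, up_dnF, dn_upF).

Lemma scaleC_apply {T : Type} (c : C) (x : T -> C^o) b : (c *: x) b = c * x b.
Proof. by []. Qed.
Lemma add_apply {T : Type} (x y : T -> C^o) b : (x + y) b = x b + y b.
Proof. by []. Qed.
Lemma sub_apply {T : Type} (x y : T -> C^o) b : (x - y) b = x b - y b.
Proof. by []. Qed.

Lemma composable_inv (P : arrow -> arrow -> Om11 -> Prop) :
  (forall k (H : @tgt Om1 (up k) = @src Om1 (up k.+1)),
     P (up k) (up k.+1) (cpair H)) ->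
  (forall k (H : @tgt Om1 (dn k.+1) = @src Om1 (dn k)),
     P (dn k.+1) (dn k) (cpair H)) ->
  (forall k, P (up k) (dn k) (up_dn k)) ->
  (forall k, P (dn k) (up k) (dn_up k)) ->
  forall p : Om11, P (val p).1 (val p).2 p.
Proof.
move=> Puu Pdd Pud Pdu [[[i|i] [j|j]] ij]; move/eqP: (ij) => /= E.
- subst j; rewrite (_ : exist _ _ _ = @cpair Om1 Om1 (up i) (up i.+1) erefl) //.
  exact: val_inj.
- case: E => E; subst j; rewrite (_ : exist _ _ _ = up_dn i) //; exact: val_inj.
- subst j; rewrite (_ : exist _ _ _ = dn_up i) //; exact: val_inj.
- subst i; rewrite (_ : exist _ _ _ = @cpair Om1 Om1 (dn j.+1) (dn j) erefl) //.
  exact: val_inj.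
Qed.

Lemma om11_eqE (p q : Om11) :
  (p == q) = ((val p).1 == (val q).1) && ((val p).2 == (val q).2).
Proof. by rewrite -(inj_eq val_inj). Qed.

(** The inverse metric sees only the two loops based at a vertex, one through the next vertex and
    one through the previous; the first vertex has only the former. *)
Lemma ipE (h : nat -> R) (x : form Om11) v :
  ip h x v = x (up_dn v) * ((h v.+1)^-1)%:C%C +
    (if v is w.+1 then x (dn_up w) * ((h w.+1 * phi R w.+1)^-1)%:C%C else 0).
Proof.
rewrite /ip (@ext_seq _ _ _ _ _ _
  (up_dn v :: if v is w.+1 then [:: dn_up w] else [::])).
- rewrite big_cons /= scaleC_apply /Defs.e eqxx mulr1.
  case: v => [|w]; first by rewrite big_nil.
  by rewrite big_seq1 /= scaleC_apply eqxx mulr1.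
- by case: v => // w; rewrite /= mem_seq1 om11_eqE.
- elim/composable_inv => k //=.
  + rewrite in_cons negb_or om11_eqE /= !arrow_eqE andbb => /andP[kv _].
    by rewrite scaleC_apply /Defs.e eq_sym (negbTE kv) mulr0.
  + rewrite in_cons negb_or scaleC_apply /Defs.e => /andP[_].
    case: v => [|w]; first by rewrite mulr0.
    rewrite mem_seq1 om11_eqE /= !arrow_eqE andbb eqSS eq_sym => /negbTE ->.
    by rewrite mulr0.
Qed.

Lemma iotaE (x : form Om2) (p : Om11) :
  Defs.iota x p = match val p with
    | (up k.+1, dn _) => x k / 2
    | (dn k, up _) => - (x k / 2)
    | _ => 0
    end.
Proof.
have E (k : Om2) q : ((2^-1 : C) *: (tens (e (up k.+1 : Om1)) (e (dn k.+1 : Om1))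
    - tens (e (dn k : Om1)) (e (up k : Om1)))) q
  = 2^-1 * ((((val q).1 == up k.+1) && ((val q).2 == dn k.+1))%:R
    - (((val q).1 == dn k) && ((val q).2 == up k))%:R).
  by rewrite scaleC_apply sub_apply /tens /Defs.e -!natrM !mulnb.
(* [Z] covers the paths that [iota] never produces: the straight ones and the loop at vertex 1,
   whose class in [Om2] is zero. *)
have Z (q : Om11) : (forall k, (val q).1 <> up k.+1 \/ (val q).2 <> dn k.+1) ->
    (forall k, (val q).1 <> dn k \/ (val q).2 <> up k) -> Defs.iota x q = 0.
  move=> H1 H2; rewrite /Defs.iota (@ext_seq _ _ _ _ _ _ [::]) ?big_nil // => k _.
  rewrite E (_ : _ && _ = false); last first.
    by apply/negP => /andP[/eqP ? /eqP ?]; case: (H1 k).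
  rewrite (_ : _ && _ = false) ?subrr ?mulr0 //.
  by apply/negP => /andP[/eqP ? /eqP ?]; case: (H2 k).
elim/composable_inv: p => [k H|k H|[|k]|k].
- by rewrite Z => [|j|j]; [case: k H|right|left].
- by rewrite Z => [|j|j]; [|left|right].
- by rewrite Z => [|j|j]; [|left|left].
- rewrite /Defs.iota (@ext1 _ _ _ _ _ _ (k : Om2)) => [|b bk].
    by rewrite E /= !arrow_eqE eqxx /= subr0 mulr1.
  by rewrite E /= !arrow_eqE eqSS eq_sym (negbTE bk) subrr mulr0.
- rewrite /Defs.iota (@ext1 _ _ _ _ _ _ (k : Om2)) => [|b bk].
    by rewrite E /= !arrow_eqE eqxx /= sub0r mulrN1 mulrN.
  by rewrite E /= !arrow_eqE eq_sym (negbTE bk) subrr mulr0.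
Qed.

Section Connection.
Variables (s : R) (h : nat -> R).

Lemma up_dnE k : up_dn k = @cpair Om1 Om1 (up k) (dn k) erefl.
Proof. exact: val_inj. Qed.
Lemma dn_upE k : dn_up k = @cpair Om1 Om1 (dn k) (up k) erefl.
Proof. exact: val_inj. Qed.

(** Shows that the image under [sigma] of a path other than the selected ones has coefficient 0 at
    the path in question. *)
Ltac sigma_off :=
  rewrite ?add_apply ?scaleC_apply /tens /Defs.e /= ?om11_eqE /= ?arrow_eqE
    ?(mul0r, mulr0, addr0, add0r, orbF) //;
  rewrite ?eqSS ?andbb eq_sym => /negbTE ->; rewrite mul0r mulr0.

(** A bimodule map preserves endpoints. A straight path is the only 2-step path between its ends,
    hence is only rescaled, as is the loop at vertex 1; at every other vertex the two loops mix. *)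
Lemma sigmaE (x : form Om11) (p : Om11) :
  sigma s h x p = match val p with
    | (up k, up _) => x p * (sig s h k.+1)%:C%C
    | (dn k.+1, dn _) => x p * (sig' s h k.+2)%:C%C
    | (up 0, dn _) => x (up_dn 0) * (tau s 1)%:C%C
    | (up k.+1, dn _) => x (up_dn k.+1) * (tau s k.+2)%:C%C
                       + x (dn_up k) * (1 + tau' s k.+1)%:C%C
    | (dn k, up _) => x (up_dn k.+1) * (1 + tau s k.+2)%:C%C
                    + x (dn_up k) * (tau' s k.+1)%:C%C
    | (dn 0, dn _) => 0
    end.
Proof.
rewrite /sigma.
elim/composable_inv: p => [[|k] H|k H|[|[|k]]|[|k]].
- rewrite (@ext1 _ _ _ _ _ _ (cpair H)) /=.
    by rewrite scaleC_apply /tens /Defs.e /= ?eqxx !mulr1.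
  by elim/composable_inv => [[|j] J|j J|[|j]|[|j]] /=; sigma_off.
- rewrite (@ext1 _ _ _ _ _ _ (cpair H)) /=.
    by rewrite scaleC_apply /tens /Defs.e /= ?eqxx !mulr1.
  by elim/composable_inv => [[|j] J|j J|[|j]|[|j]] /=; sigma_off.
- rewrite (@ext1 _ _ _ _ _ _ (cpair H)) /=.
    by rewrite scaleC_apply /tens /Defs.e /= ?eqxx !mulr1.
  by elim/composable_inv => [[|j] J|j J|[|j]|[|j]] /=; sigma_off.
- rewrite (@ext1 _ _ _ _ _ _ (up_dn 0)) /=.
    by rewrite scaleC_apply /tens /Defs.e /= ?eqxx !mulr1.
  by elim/composable_inv => [[|j] J|j J|[|j]|[|j]] /=; sigma_off.
- rewrite (@ext_seq _ _ _ _ _ _ [:: up_dn 1; dn_up 0]) //.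
    rewrite !big_cons big_nil /= !add_apply !scaleC_apply /tens /Defs.e /=.
    by rewrite ?arrow_eqE ?eqxx !(mulr0, mulr1, addr0, add0r).
  by elim/composable_inv => [[|j] J|j J|[|j]|[|j]] /=; rewrite ?inE; sigma_off.
- rewrite (@ext_seq _ _ _ _ _ _ [:: up_dn k.+2; dn_up k.+1]) //.
    rewrite !big_cons big_nil /= !add_apply !scaleC_apply /tens /Defs.e /=.
    by rewrite ?arrow_eqE ?eqxx !(mulr0, mulr1, addr0, add0r).
  by elim/composable_inv => [[|j] J|j J|[|j]|[|j]] /=; rewrite ?inE; sigma_off.
- rewrite (@ext_seq _ _ _ _ _ _ [:: up_dn 1; dn_up 0]) //.
    rewrite !big_cons big_nil /= !add_apply !scaleC_apply /tens /Defs.e /=.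
    by rewrite ?arrow_eqE ?eqxx !(mulr0, mulr1, addr0, add0r).
  by elim/composable_inv => [[|j] J|j J|[|j]|[|j]] /=; rewrite ?inE; sigma_off.
- rewrite (@ext_seq _ _ _ _ _ _ [:: up_dn k.+2; dn_up k.+1]) //.
    rewrite !big_cons big_nil /= !add_apply !scaleC_apply /tens /Defs.e /=.
    by rewrite ?arrow_eqE ?eqxx !(mulr0, mulr1, addr0, add0r).
  by elim/composable_inv => [[|j] J|j J|[|j]|[|j]] /=; rewrite ?inE; sigma_off.
Qed.

(* The coefficient of [u.1 (x) u.2] in [nabla c]; junk if [u] is not composable. *)
Definition nabla_coef (c : arrow) (u : arrow * arrow) : R :=
  (u.2 == c)%:R - match u.1, u.2 with
    | up k, up _ => (up k == c)%:R * sig s h k.+1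
    | dn k, dn _ => if k is 0 then 0 else (dn k == c)%:R * sig' s h k.+1
    | up k, dn _ => (up k == c)%:R * tau s k.+1
        + (if k is k'.+1 then (dn k' == c)%:R * (1 + tau' s k) else 0)
    | dn k, up _ => (up k.+1 == c)%:R * (1 + tau s k.+2)
                    + (dn k == c)%:R * tau' s k.+1
    end.

(** All structure constants are real, so the computations from here on can take place in [R]. *)
Lemma nablaE (c : Om1) (p : Om11) :
  nabla s h (e c) p = (nabla_coef c (val p))%:C%C.
Proof.
rewrite /nabla sub_apply sigmaE /tens /theta /Defs.e /nabla_coef mul1r.
elim/composable_inv: p => [[|k] H|k H|[|k]|[|k]] /=;
  by rewrite ?mulr1 ?addr0 -!(rmorph_nat (real_complex R)) -?rmorphM
    -?rmorphD -?rmorphB.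
Qed.

Lemma d1E (x : form Om1) (k : Om2) :
  d1 x k = x (dn k.+1) - x (up k) + (x (up k.+1) - x (dn k)).
Proof. by rewrite /d1 add_apply !wedgeE /tens /theta /= !mul1r !mulr1. Qed.

(* The coefficient of [[k] (x) d] in [(d (x) id - id /\ nabla) (u.1 (x) u.2)]. *)
Definition curvature_coef (k : nat) (d : arrow) (u : arrow * arrow) : R :=
  ((dn k.+1 == u.1)%:R - (up k == u.1)%:R +
     ((up k.+1 == u.1)%:R - (dn k == u.1)%:R)) * (d == u.2)%:R
  - ((up k.+1 == u.1)%:R * nabla_coef u.2 (dn k.+1, d)
     - (dn k == u.1)%:R * nabla_coef u.2 (up k, d)).

Lemma lmap_wedgeE {D : basis} (x : form (tensor Om11 D)) q :
  lmap (@wedge R) x q = @wedge R (slicer x (val q).2) (val q).1.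
Proof. exact: lmapE. Qed.

(** The cell [k] has only two representing loops, [up_dn k.+1] and [dn_up k]. Hence the term with
    [nabla] contributes only for paths that begin with the first arrow of one of them. *)
Lemma RnablaE (x : form Om1) (k : Om2) (d : Om1) (kd : tgt k = src d)
    (l : seq Om11) : uniq l -> (forall p, p \notin l -> nabla s h x p = 0) ->
  Rnabla s h x (cpair kd) =
  \sum_(p <- l) nabla s h x p * (curvature_coef k d (val p))%:C%C.
Proof.
move=> ul l0; rewrite /Rnabla (@ext_support _ _ _ _ _ _ l) //.
apply: eq_bigr => -[[b c] /= bc] _; congr (_ * _).
rewrite sub_apply lmap_wedgeE wedgeE /= [tens (d1 _) _ _]/tens /= d1E.
rewrite up_dnE dn_upE.
rewrite (@slicer_cpair _ Om11 Om1 _ (@cpair Om1 Om1 (up k.+1) (dn k.+1) erefl) d kd).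
rewrite (@slicer_cpair _ Om11 Om1 _ (@cpair Om1 Om1 (dn k) (up k) erefl) d kd).
rewrite (@assoclE _ Om1 Om1 Om1 _ (up k.+1) (dn k.+1) d erefl kd).
rewrite (@assoclE _ Om1 Om1 Om1 _ (dn k) (up k) d erefl kd).
rewrite /tens /= !nablaE /= /curvature_coef /Defs.e /=.
by rewrite -!(rmorph_nat (real_complex R)) -?rmorphM -?rmorphD -?rmorphB
  -?rmorphM -?rmorphD -?rmorphB -?rmorphM -?rmorphB.
Qed.

End Connection.
End Operators.

(** * The two curvature coefficients that enter the Ricci scalar *)

Section Curvature.
Context {R : realType}.
Variables (s : R) (h : nat -> R).
Local Notation e := (Defs.e R).

Lemma eqnSF n : (n == n.+1) = false. Proof. by elim: n. Qed.
Lemma eqSnF n : (n.+1 == n) = false. Proof. by rewrite eq_sym eqnSF. Qed.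
Lemma eqnSSF n : (n == n.+2) = false. Proof. by elim: n. Qed.
Lemma eqSSnF n : (n.+2 == n) = false. Proof. by rewrite eq_sym eqnSSF. Qed.
Definition succ_eqE := (eqSS, eqnSF, eqSnF, eqnSSF, eqSSnF, eqxx).

Lemma Rnabla_coefE (c : Om1) (k : Om2) (d : Om1) (kd : tgt k = src d)
    (l : seq Om11) :
  uniq l -> (forall p : Om11, p \notin l -> nabla_coef s h c (val p) = 0) ->
  Rnabla s h (e c) (cpair kd) =
  (\sum_(p <- l) nabla_coef s h c (val p) * curvature_coef s h k d (val p))%:C%C.
Proof.
move=> ul l0; rewrite (@RnablaE _ _ _ _ _ _ _ l) // => [|p /l0 p0].
  rewrite (rmorph_sum (real_complex R)); apply: eq_bigr => p _.
  by rewrite nablaE -rmorphM.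
by rewrite nablaE p0.
Qed.

(* With i = v+1, the coefficient of [a_{i+1} /\ a'_{i+1}] (x) a'_i in the
   curvature of a'_i. *)
Definition curvature_dn v : R :=
  tau s v.+1 * tau' s v.+1 - (1 + tau' s v.+1) * sig' s h v.+2
  + (if v is w.+1 then sig' s h v.+1 * (1 + tau' s v) else 0).

(* With i = w+2, the coefficient of [a_i /\ a'_i] (x) a_i in the curvature of
   a_i. *)
Definition curvature_up w : R :=
  (1 + tau s w.+2) * sig s h w.+1 - tau s w.+2 * tau' s w.+2
  - sig s h w.+2 * (1 + tau s w.+3).

(** Checks, for each kind of path, that [nabla] of a basis arrow vanishes outside the listed
    paths. *)
Ltac support :=
  elim/composable_inv => [[|k] H|[|k] H|[|[|k]]|[|k]];
  rewrite ?inE ?om11_eqE /nabla_coef /= ?arrow_eqE ?succ_eqE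
    ?(andbF, andbT, orbF, andbb) ?negb_or /= -?andbA;
  repeat (try (case/andP); let E := fresh in move=> /negbTE E; rewrite ?E);
  rewrite ?(mul0r, addr0, subr0) //.

Ltac evaluate_curvature :=
  congr (_%:C)%C; rewrite !big_cons big_nil /nabla_coef /curvature_coef
    /= ?arrow_eqE ?succ_eqE /= /nabla_coef /= ?arrow_eqE ?succ_eqE /=.

(** In each list the first two paths come from [theta] tensored with the arrow, the others from
    [sigma]. For [v = 0] the straight path that would continue below vertex 1 is missing. *)
Lemma Rnabla_dn v :
  Rnabla s h (e (dn v : Om1)) (@cpair Om2 Om1 v (dn v) erefl)
  = (curvature_dn v)%:C%C.
Proof.
case: v => [|w].
  rewrite (@Rnabla_coefE _ _ _ _ [:: @cpair Om1 Om1 (dn 1) (dn 0) erefl;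
    up_dn 0; up_dn 1; dn_up 0]) //; last by support.
  by evaluate_curvature; rewrite /curvature_dn; ring.
rewrite (@Rnabla_coefE _ _ _ _ [:: @cpair Om1 Om1 (dn w.+2) (dn w.+1) erefl;
    up_dn w.+1; up_dn w.+2; dn_up w.+1; @cpair Om1 Om1 (dn w.+1) (dn w) erefl]).
- by evaluate_curvature; rewrite /curvature_dn; ring.
- by rewrite /= ?inE !om11_eqE /= !arrow_eqE !succ_eqE.
- by support.
Qed.

Lemma Rnabla_up w :
  Rnabla s h (e (up w.+1 : Om1)) (@cpair Om2 Om1 w (up w.+1) erefl)
  = (curvature_up w)%:C%C.
Proof.
rewrite (@Rnabla_coefE _ _ _ _ [:: @cpair Om1 Om1 (up w) (up w.+1) erefl;
    dn_up w.+1; @cpair Om1 Om1 (up w.+1) (up w.+2) erefl; up_dn w.+1; dn_up w]).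
- by evaluate_curvature; rewrite /curvature_up; ring.
- by rewrite /= ?inE !om11_eqE /= !arrow_eqE !succ_eqE.
- by support.
Qed.
End Curvature.

(** * Ricci tensor and Ricci scalar in terms of the curvature coefficients *)

Section RicciScalar.
Context {R : realType}.
Variables (s : R) (h : nat -> R).
Local Notation form B := (Defs.form R B).
Local Notation e := (Defs.e R).

Definition rev_arrow (b : Om1) : Om1 :=
  match b with up k => dn k | dn k => up k end.

Lemma rev_arrow_src (b : Om1) : @tgt Om1 b = @src Om1 (rev_arrow b).
Proof. by case: b. Qed.

Lemma slicel_metric (b c : Om1) : c != rev_arrow b ->
  slicel (metric h) b c = 0.
Proof.
rewrite /slicel; case: insubP => //= -[[x y] /= xy] _ [xb yc]; subst x y.
rewrite /metric /=; case: b c xy => [i|i] [j|j] //= xy /negP[].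
  by rewrite dn_eq; move/eqP: xy => /= -[->].
by rewrite up_eq; move/eqP: xy => /= ->.
Qed.

(** The metric pairs each arrow only with its reverse, so a fixed first arrow leaves a single
    curvature term. *)
Lemma rmap_RnablaE (b d : Om1) (k : Om2) (kd : tgt k = src d)
    (bk : @tgt Om1 b = @src (tensor Om2 Om1) (cpair kd)) :
  rmap (Rnabla s h) (metric h) (@cpair Om1 (tensor Om2 Om1) _ _ bk) =
  metric h (cpair (rev_arrow_src b)) * Rnabla s h (e (rev_arrow b : Om1)) (cpair kd).
Proof.
rewrite rmap_extE /= (@ext_support _ _ _ _ _ _ [:: rev_arrow b]) //.
  by rewrite big_seq1 /= (slicel_cpair _ _ _ (rev_arrow_src b)).
by move=> c; rewrite mem_seq1 => /slicel_metric.
Qed.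

Lemma lmap_ipE {D : basis} (x : form (tensor Om11 D)) q :
  lmap (ip h) x q = ip h (slicer x (val q).2) (val q).1.
Proof. exact: lmapE. Qed.
Lemma lmap_iotaE {D : basis} (x : form (tensor Om2 D)) q :
  lmap (@Defs.iota R) x q = @Defs.iota R (slicer x (val q).2) (val q).1.
Proof. exact: lmapE. Qed.
Lemma rmap_assocrE {A B D E : basis} (x : form (tensor A (tensor (tensor B D) E))) q :
  rmap (@assocr R B D E) x q = assocr (slicel x (val q).1) (val q).2.
Proof. exact: rmapE. Qed.
Lemma rmap_lmapE {A B B' D : basis} (f : form B -> form B')
    (x : form (tensor A (tensor B D))) q :
  rmap (lmap f) x q = lmap f (slicel x (val q).1) (val q).2.
Proof. exact: rmapE. Qed.

(** The lifting touches only the two middle factors; the outer arrows [b] and [d] stay fixed as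
    slice parameters. *)
Lemma lifted_curvatureE (b c c' d : Om1) (bc : tgt b = src c)
    (cc' : tgt c = src c') (c'd : tgt c' = src d) :
  rmap (@assocr R Om1 Om1 Om1)
    (rmap (lmap (@Defs.iota R)) (rmap (Rnabla s h) (metric h)))
    (@cpair Om1 (tensor Om1 Om11) b (@cpair Om1 Om11 c (cpair c'd) cc') bc) =
  Defs.iota (slicer (slicel (rmap (Rnabla s h) (metric h)) b) d) (cpair cc').
Proof.
rewrite rmap_assocrE /= assocrE.
rewrite (@slicel_cpair _ Om1 (tensor Om11 Om1) _ b
  (@cpair Om11 Om1 (cpair cc') d c'd) bc).
by rewrite rmap_lmapE /= lmap_iotaE.
Qed.

Local Notation metric_curvature := (rmap (Rnabla s h) (metric h)).

(** The contraction runs over the loops based where [c'] starts. At vertex 1 there is one such loop;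
    the next lemma treats the other vertices, with two. *)
Lemma Ricci_loop0 (c' d : Om1) (c'd : tgt c' = src d)
    (vc' : @tgt Om1 (dn 0) = src c') :
  Ricci s h (cpair c'd) =
  Defs.iota (slicer (slicel metric_curvature (up 0)) d) (cpair vc') * ((h 1)^-1)%:C%C.
Proof.
rewrite /Ricci unitlE lmap_ipE ipE /=.
have /= <- := vc'; rewrite up_dnE addr0.
rewrite (@slicer_cpair _ Om11 Om11 _ (@cpair Om1 Om1 (up 0) (dn 0) erefl)
  (cpair c'd) vc').
rewrite (@assoclE _ Om1 Om1 Om11 _ (up 0) (dn 0) (cpair c'd) erefl vc').
by rewrite lifted_curvatureE.
Qed.

Lemma Ricci_loopS (c' d : Om1) (c'd : tgt c' = src d) (w : nat)
    (vc' : @tgt Om1 (dn w.+1) = src c') (wc' : @tgt Om1 (up w) = src c') :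
  Ricci s h (cpair c'd) =
  Defs.iota (slicer (slicel metric_curvature (up w.+1)) d) (cpair vc')
    * ((h w.+2)^-1)%:C%C
  + Defs.iota (slicer (slicel metric_curvature (dn w)) d) (cpair wc')
    * ((h w.+1 * phi R w.+1)^-1)%:C%C.
Proof.
rewrite /Ricci unitlE lmap_ipE ipE /=.
have /= <- := vc'; rewrite up_dnE dn_upE.
rewrite (@slicer_cpair _ Om11 Om11 _ (@cpair Om1 Om1 (up w.+1) (dn w.+1) erefl)
  (cpair c'd) vc').
rewrite (@slicer_cpair _ Om11 Om11 _ (@cpair Om1 Om1 (dn w) (up w) erefl)
  (cpair c'd) wc').
rewrite (@assoclE _ Om1 Om1 Om11 _ (up w.+1) (dn w.+1) (cpair c'd) erefl vc').
rewrite (@assoclE _ Om1 Om1 Om11 _ (dn w) (up w) (cpair c'd) erefl wc').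
by rewrite !lifted_curvatureE.
Qed.

Hypothesis h_neq0 : forall i, (0 < i)%N -> h i != 0.

Lemma phi_neq0 i : (0 < i)%N -> phi R i != 0.
Proof. by move=> i0; rewrite mulf_neq0 ?invr_eq0 ?pnatr_eq0 -?lt0n. Qed.

Lemma lifted_curvature_up v :
  Defs.iota (slicer (slicel metric_curvature (up v)) (dn v))
    (@cpair Om1 Om1 (dn v) (up v) erefl)
  = (- (h v.+1 * phi R v.+1 * curvature_dn s h v / 2))%:C%C.
Proof.
rewrite iotaE /= (@slicer_cpair _ Om2 Om1 _ v (dn v) erefl).
rewrite (@slicel_cpair _ Om1 (tensor Om2 Om1) _ (up v)
  (@cpair Om2 Om1 v (dn v) erefl) erefl).
rewrite rmap_RnablaE Rnabla_dn /=.
by rewrite -(rmorph_nat (real_complex R)) -fmorphV -!rmorphM -rmorphN.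
Qed.

Lemma lifted_curvature_dn w :
  Defs.iota (slicer (slicel metric_curvature (dn w.+1)) (up w.+1))
    (@cpair Om1 Om1 (up w.+1) (dn w.+1) erefl)
  = (h w.+2 * curvature_up s h w / 2)%:C%C.
Proof.
rewrite iotaE /= (@slicer_cpair _ Om2 Om1 _ w (up w.+1) erefl).
rewrite (@slicel_cpair _ Om1 (tensor Om2 Om1) _ (dn w.+1)
  (@cpair Om2 Om1 w (up w.+1) erefl) erefl).
rewrite rmap_RnablaE Rnabla_up /=.
by rewrite -(rmorph_nat (real_complex R)) -fmorphV -!rmorphM.
Qed.

Lemma Ricci_up_dn v :
  Ricci s h (up_dn v) = (- (phi R v.+1 * curvature_dn s h v / 2))%:C%C.
Proof.
have h0 := @h_neq0 v.+1 isT.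
rewrite up_dnE; case: v h0 => [|w] h0.
  rewrite (@Ricci_loop0 (up 0) (dn 0) erefl erefl) lifted_curvature_up -rmorphM.
  by congr (_%:C)%C; field.
rewrite (@Ricci_loopS (up w.+1) (dn w.+1) erefl w erefl erefl) lifted_curvature_up.
(* The loop through the previous vertex would need the lifting on the straight path [up w],
   [up w.+1], where it is zero. *)
rewrite [X in _ + X * _](_ : _ = 0); last by rewrite iotaE; case: w {h0}.
rewrite mul0r addr0 -rmorphM.
by congr (_%:C)%C; field.
Qed.

Lemma Ricci_dn_up w :
  Ricci s h (dn_up w) =
  ((if w is u.+1 then curvature_up s h u else 0) / (2 * phi R w.+1))%:C%C.
Proof.
have h0 := @h_neq0 w.+1 isT; have p0 := @phi_neq0 w.+1 isT.
rewrite dn_upE (@Ricci_loopS (dn w) (up w) erefl w erefl erefl) [X in X * _]iotaE /=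
  mul0r add0r.
(* For [w = 0] the lifting is evaluated on the loop at vertex 1, where it is zero. *)
case: w h0 p0 => [|u] h0 p0; first by rewrite iotaE /= !mul0r.
by rewrite lifted_curvature_dn -rmorphM; congr (_%:C)%C; field; rewrite h0 p0.
Qed.

(** One factor [phi] in the square comes from the contraction in [Ricci], the other from the final
    one. The second term is absent at vertex 1, which has no loop downwards, and at vertex 2, where
    the Ricci coefficient of that loop vanishes. *)
Lemma ricci_scalarE v :
  ricci_scalar s h v =
  (- (phi R v.+1 * curvature_dn s h v / 2 / h v.+1)
   + (if v is w.+2 then
        curvature_up s h w / (2 * phi R w.+2 ^+ 2 * h w.+2) else 0))%:C%C.
Proof.
have h0 := @h_neq0.
rewrite /ricci_scalar ipE Ricci_up_dn; case: v => [|[|w]].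
- by rewrite -rmorphM addr0; congr (_%:C)%C; rewrite mulNr addr0.
- by rewrite Ricci_dn_up !mul0r /= -rmorphM !addr0; congr (_%:C)%C; rewrite mulNr.
- rewrite Ricci_dn_up -!rmorphM -rmorphD; congr (_%:C)%C.
  by field; rewrite !h0 ?phi_neq0.
Qed.
End RicciScalar.

(** * Vanishing of the Ricci scalar as a first-order recursion for the metric *)

Section Flatness.
Context {R : realType}.
Variable s : R.
Hypothesis s_sign : s = 1 \/ s = -1.

(** Absorbs [s] and the alternating factor into one sign [x], so that later identities become
    rational ones, checked for [x = 1] and [x = -1]. *)
Lemma tau_sign i : exists2 x : R, x = 1 \/ x = -1 &
  tau s i.+1 = x / i.+1%:R /\ tau s i.+2 = - x / i.+2%:R.
Proof.
exists (s * (-1) ^+ i); last by rewrite /tau /= exprS mulN1r mulrN.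
rewrite -signr_odd; case: s_sign => ->; case: (odd i);
  rewrite /= ?expr0 ?expr1 ?mulr1 ?mulrNN ?mul1r; by [left|right].
Qed.

(* The value of h_{k+2} / h_{k+1} for a flat metric. *)
Definition flat_ratio k : R :=
  k.+2%:R / k.+1%:R * ((1 - tau s k.+2) / (1 + tau s k.+2)).

(** The absolute value of tau_{k+2} is 1/(k+2) < 1. The index starts at 2 because tau_1 is 1 or
    -1. *)
Lemma oneDtau_neq0 k : 1 + tau s k.+2 != 0 /\ 1 - tau s k.+2 != 0.
Proof.
have [x x1 [_ ->]] := tau_sign k.
have k0 : k.+2%:R != 0 :> R by rewrite pnatr_eq0.
have E (y n : R) : n != 0 -> 1 + y / n = (n + y) / n by move=> ?; field.
rewrite -mulNr !E //.
have k1 := ler0n R k.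
by split; apply: mulf_neq0; rewrite ?invr_eq0 // -!natr1;
  case: x1 => ->; apply: lt0r_neq0; lra.
Qed.

Lemma flat_ratio_neq0 k : flat_ratio k != 0.
Proof.
have [t0 t1] := oneDtau_neq0 k.
by rewrite !mulf_neq0 ?invr_eq0 ?pnatr_eq0.
Qed.

Section Metric.
Variable h : nat -> R.
Hypothesis h_neq0 : forall i, (0 < i)%N -> h i != 0.

(** With i = w+2, the recursion and tau_j^2 = 1/j^2 turn the three terms into (i+1)/i - 1/(i(i+1)) -
    (i+2)/(i+1) = 0. *)
Lemma curvature_up_eq0 w :
  h w.+2 = h w.+1 * flat_ratio w -> h w.+3 = h w.+2 * flat_ratio w.+1 ->
  curvature_up s h w = 0.
Proof.
have h1 := @h_neq0 w.+1 isT.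
have [t0 t1] := oneDtau_neq0 w; have [u0 u1] := oneDtau_neq0 w.+1.
move=> e1 e2; rewrite /curvature_up /sig e2 e1 /flat_ratio /tau'.
have [x x1 [tE uE]] := tau_sign w.+1; move: t0 t1 u0 u1; rewrite tE uE.
(* Written in terms of w >= 0, the denominators left by [field] are visibly positive. *)
rewrite -!natr1; have m0 := ler0n R w.
by case: x1 => -> _ _ _ _; field; rewrite h1 -?andbA;
  repeat (apply/andP; split); rewrite ?andbT //; apply: lt0r_neq0; lra.
Qed.

(** With i = v+1, the first term is 1/(i(i+1)) and, by the recursion one step earlier, the last is
    (i-1)/i; they add up to i/(i+1). For i = 1 the last term is absent and the assumption is
    vacuous, with the same sum. *)
Lemma curvature_dnE v :
  (forall w, v = w.+1 -> h w.+2 = h w.+1 * flat_ratio w) ->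
  curvature_dn s h v =
  v.+1%:R / v.+2%:R * (1 - h v.+1 * flat_ratio v / h v.+2).
Proof.
have h1 := @h_neq0 v.+1 isT; have h2 := @h_neq0 v.+2 isT.
have [t0 t1] := oneDtau_neq0 v.
have [x x1 [tE uE]] := tau_sign v.
move: t0 t1; rewrite /curvature_dn /flat_ratio /sig' /tau' /= tE uE => t0 t1.
case: v => [|w] in h1 h2 tE uE t0 t1 * => [_|/(_ w erefl) e1].
  by move: t0 t1; case: x1 => -> _ _; field; rewrite h2.
have h0 := @h_neq0 w.+1 isT.
rewrite e1 /flat_ratio tE; move: t0 t1; rewrite -!natr1; have m0 := ler0n R w.
by case: x1 => -> _ _; field; rewrite h2 h0 -?andbA;
  repeat (apply/andP; split); rewrite ?andbT //; apply: lt0r_neq0; lra.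
Qed.

Lemma curvature_dn_eq0 v :
  (forall w, v = w.+1 -> h w.+2 = h w.+1 * flat_ratio w) ->
  curvature_dn s h v = 0 <-> h v.+2 = h v.+1 * flat_ratio v.
Proof.
have h2 := @h_neq0 v.+2 isT.
move=> /curvature_dnE ->; split=> [/eqP|<-]; last by rewrite divff // subrr mulr0.
rewrite !mulf_eq0 invr_eq0 !pnatr_eq0 /= subr_eq0 => /eqP /esym e1.
by rewrite -[LHS]mul1r -e1 divfK.
Qed.
End Metric.

Lemma ricci_scalar_flatP (h : nat -> R) :
  ricci_scalar_flat s h <->
  h 1 != 0 /\ forall k, h k.+2 = h k.+1 * flat_ratio k.
Proof.
split=> [[h0 S0]|[h1 hr]].
  have cancel_factors (p c q : R) : p != 0 -> q != 0 -> - (p * c / 2 / q) = 0 -> c = 0.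
    move=> /negbTE p0 /negbTE q0 /eqP.
    by rewrite oppr_eq0 !mulf_eq0 !invr_eq0 p0 q0 pnatr_eq0 !orbF => /eqP.
  split; first exact: h0.
  (* Strong induction, since removing the second term of the scalar at [v] uses the relations for
     [v-1] and [v-2]. *)
  elim/ltn_ind => v IH.
  have prev w : v = w.+1 -> h w.+2 = h w.+1 * flat_ratio w.
    by move=> vw; apply: IH; rewrite vw.
  apply/(curvature_dn_eq0 h h0 _ prev).
  have /= := congr1 (@^~ v) S0; rewrite ricci_scalarE // => -[].
  rewrite (_ : (if v is w.+2 then _ else _) = 0) ?addr0.
    exact: cancel_factors (phi_neq0 v.+1 isT) (h0 v.+1 isT).
  case: v IH {prev} => [|[|w]] // IH.
  by rewrite curvature_up_eq0 ?mul0r //; apply: IH.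
have h0 i : (0 < i)%N -> h i != 0.
  case: i => // i _; elim: i => // i IH.
  by rewrite hr mulf_neq0 // flat_ratio_neq0.
split=> //; apply/funext => v; rewrite ricci_scalarE //.
rewrite (curvature_dn_eq0 h h0 v (fun w _ => hr w)).2 //.
rewrite mulr0 !mul0r oppr0 add0r.
by case: v => [|[|w]] //; rewrite curvature_up_eq0 ?mul0r.
Qed.

(** * The closed forms solve the recursion *)

Lemma natr_double n : n.*2%:R = n%:R + n%:R :> R.
Proof. by rewrite -addnn natrD. Qed.

Lemma flat_seq1 (h1 : R) : flat_seq s h1 1 = h1.
Proof.
rewrite /flat_seq; case: ifP => _; rewrite /flat_plus /flat_minus /=.
  by field.
by field.
Qed.

Lemma flat_seq_ratio (h1 : R) k :
  flat_seq s h1 k.+2 = flat_seq s h1 k.+1 * flat_ratio k.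
Proof.
have N1 : (-1 == 1 :> R) = false by apply/eqP => ?; lra.
rewrite /flat_ratio /tau /= -signr_odd /=.
(* Writing k as 2m or 2m+1 makes the rounding and the sign of tau explicit; for each [s] a rational
   identity in m remains. *)
rewrite -[k]odd_double_half; move: k./2 => m; have m0 := ler0n R m.
by case: (odd k); rewrite ?add1n ?add0n /flat_seq; case: s_sign => ->;
  rewrite ?eqxx ?N1 /flat_plus /flat_minus /= ?odd_double /= ?expr0 ?expr1
    ?doubleK ?uphalf_double ?mul2n ?addn1 -!natr1 ?natr_double -?natr1;
  field; rewrite -?andbA; repeat (apply/andP; split); apply: lt0r_neq0; lra.
Qed.

Lemma flat_seqP (h : nat -> R) : ricci_scalar_flat s h <->
  h 1 != 0 /\ forall i, (0 < i)%N -> h i = flat_seq s (h 1) i.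
Proof.
rewrite ricci_scalar_flatP; split=> -[h1 hr]; split=> //.
  case=> // i _; elim: i => [|i IH]; first by rewrite flat_seq1.
  by rewrite hr flat_seq_ratio IH.
by move=> k; rewrite hr // flat_seq_ratio -hr.
Qed.

(** Identifies the freedom in the initial value with the overall normalisation. *)
Lemma flat_seqZ (c h1 : R) i : flat_seq s (c * h1) i = c * flat_seq s h1 i.
Proof. by rewrite /flat_seq /flat_plus /flat_minus; case: ifP => _; ring. Qed.

End Flatness.

Theorem proposition6p1 (R : realType) (s : R) (hs : s = 1 \/ s = -1) :
  (* existence and uniqueness up to overall normalisation *)
  (exists h : nat -> R, ricci_scalar_flat s h /\
     forall h' : nat -> R, ricci_scalar_flat s h' <->
       exists2 c : R, c != 0 & forall i : nat, (0 < i)%N -> h' i = c * h i) /\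
  (* the explicit solutions, for any initial value *)
  (forall h1 : R, h1 != 0 ->
     flat_seq s h1 1%N = h1 /\ ricci_scalar_flat s (flat_seq s h1)) /\
  (forall h : nat -> R, ricci_scalar_flat s h ->
     forall i : nat, (0 < i)%N -> h i = flat_seq s (h 1%N) i) /\
  (* the equality of the two forms of each explicit solution *)
  (forall (h1 : R) (i : nat), (0 < i)%N ->
     flat_plus h1 i =
       2 * h1 * (if ~~ odd i then i.+1%:R else i%:R ^+ 2 / i.+1%:R)) /\
  (forall (h1 : R) (i : nat), (0 < i)%N ->
     flat_minus h1 i =
       h1 / 2 * (if ~~ odd i then i%:R ^+ 2 / i.+1%:R else i.+1%:R)).
Proof.
have solution (h1 : R) : h1 != 0 -> ricci_scalar_flat s (flat_seq s h1).
  by move=> h10; apply/(flat_seqP s hs); rewrite flat_seq1.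
split; [|split; [|split; [|split]]].
(* The reference solution has initial value 1, so the factor [c] of any other solution is its value
   at 1. *)
- exists (flat_seq s 1); split=> [|h']; first exact/solution/oner_neq0.
  rewrite (flat_seqP s hs); split=> [[h1 hE]|[c c0 hE]].
    by exists (h' 1) => // i i0; rewrite hE // -flat_seqZ mulr1.
  have h1 : h' 1 = c by rewrite hE // flat_seq1 mulr1.
  by split=> [|i i0]; rewrite h1 // hE // -flat_seqZ mulr1.
- by move=> h1 h10; split; [exact: flat_seq1|exact: solution].
- by move=> h /(flat_seqP s hs)[].
- move=> h1 i _; rewrite /flat_plus -(odd_double_half i); move: i./2 => m.
  have m0 := ler0n R m.
  by case: (odd i); rewrite ?add1n ?add0n /= ?odd_double /= ?doubleK ?uphalf_double
    ?mul2n ?addn1 -!natr1 ?natr_double -?natr1; field; apply: lt0r_neq0; lra.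
- move=> h1 i _; rewrite /flat_minus -(odd_double_half i); move: i./2 => m.
  have m0 := ler0n R m.
  by case: (odd i); rewrite ?add1n ?add0n /= ?odd_double /= ?doubleK ?uphalf_double
    ?mul2n ?addn1 -!natr1 ?natr_double -?natr1; field; apply: lt0r_neq0; lra.
Qed.
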